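(* Let $G$ be a graph. Then ${\sf sd}^*(G)=0$ if and only if $G$ has no cycle (i.e., $G$ is $K_3$-minor free).
   Context: Graphs are finite, simple and undirected, with nonempty vertex set $V=V(G)=\{1,\dots,n\}$ and edge set $E=E(G)$. ${\cal S}^n_+$ is the set of real symmetric positive semidefinite $n\times n$ matrices. For $c\in[-1,1]^{E}$, the problem ${\rm P}(G,c)$ has feasible set $\{X\in{\cal S}^n_+ : X[i,i]=1\ (i\in V),\ X[i,j]=c(ij)\ (ij\in E)\}$; ${\cal E}(G)$ is the set of $c\in[-1,1]^E$ for which this set is nonempty. A stress is a vector $\omega\in\mathbb{R}^{V\cup E}$; its matrix is $\Omega=\sum_{i\in V}\omega(i)E_{ii}+\sum_{ij\in E}\omega(ij)E_{ij}$, where $E_{ij}=({\bf e}_i{\bf e}_j^{\top}+{\bf e}_j{\bf e}_i^{\top})/2$ (a superscript on $\omega$ is inherited by $\Omega$). For a sequence $\omega^1,\dots,\omega^k$ put ${\cal V}^0=\mathbb{R}^n$ and ${\cal V}^j=\{x\in\mathbb{R}^n : x^{\top}\Omega^i x=0\ (i=1,\dots,j)\}$. Singularity degree: for $c\in{\cal E}(G)$, ${\sf sd}(G,c)=0$ if ${\rm P}(G,c)$ has a positive definite feasible solution; otherwise ${\sf sd}(G,c)$ is the smallest $k$ for which there are stresses $\omega^1,\dots,\omega^k$ such that: (1) for each $j$, $x^{\top}\Omega^j x\ge 0$ for all $x\in{\cal V}^{j-1}$; (2) for each $j$, $\sum_{i\in V}\omega^j(i)+\sum_{ij\in E}\omega^j(ij)c(ij)\le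 0$; (3) $\dim{\cal V}^k=s$, where $s$ is the maximum rank of a feasible solution of ${\rm P}(G,c)$. The nondegenerate singularity degree is ${\sf sd}^*(G)=\max\{{\sf sd}(G,c) : c\in{\cal E}(G)\cap(-1,1)^{E}\}$. *)

(* Defs.v *)
From HB Require Import structures.
From mathcomp Require Import all_boot all_order all_algebra.
From mathcomp Require Import reals.

Set Implicit Arguments.
Unset Strict Implicit.
Unset Printing Implicit Defensive.
Import Order.TTheory GRing.Theory Num.Theory.
Local Open Scope ring_scope.

Record sgraph (n : nat) := SGraph {
  adj :> rel 'I_n;
  adj_sym : symmetric adj;
  adj_irr : irreflexive adj }.

Lemma complete_sym m : symmetric (fun i j : 'I_m => i != j).
Proof. by move=> i j; rewrite eq_sym. Qed.

Lemma complete_irr m : irreflexive (fun i j : 'I_m => i != j).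
Proof. by move=> i; rewrite eqxx. Qed.

Definition complete_graph m : sgraph m :=
  SGraph (@complete_sym m) (@complete_irr m).

Definition has_cycle n (G : sgraph n) : Prop :=
  exists s : seq 'I_n, (2 < size s)%N /\ ucycle G s.

Definition connected_set n (G : sgraph n) (B : {set 'I_n}) : Prop :=
  B != set0 /\
  {in B &, forall x y,
    connect [rel u v | [&& u \in B, v \in B & G u v]] x y}.

(* H is a minor of G: the sets B i are the branch sets, which contract to the
   vertices of H. *)
Definition has_minor m n (H : sgraph m) (G : sgraph n) : Prop :=
  exists B : 'I_m -> {set 'I_n},
    [/\ forall i, connected_set G (B i),
        forall i j, i != j -> [disjoint B i & B j]
      & forall i j, H i j ->
          exists x y, [/\ x \in B i, y \in B j & G x y]].

Section PositiveSemidefinite.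
Variables (R : realType) (n : nat).
Implicit Types (X : 'M[R]_n) (x : 'rV[R]_n).

(* Vectors of R^n are row vectors, so this is the usual x^T X x. *)
Definition qform X x : R := (x *m X *m x^T) 0 0.

Definition psd X : Prop := X^T = X /\ forall x, 0 <= qform X x.

Definition posdef X : Prop := X^T = X /\ forall x, x != 0 -> 0 < qform X x.

End PositiveSemidefinite.

Definition is_least (P : nat -> Prop) (k : nat) : Prop :=
  P k /\ forall m, P m -> (k <= m)%N.

Definition is_greatest (P : nat -> Prop) (k : nat) : Prop :=
  P k /\ forall m, P m -> (m <= k)%N.

Section SingularityDegree.
Variables (R : realType) (n : nat) (G : sgraph n).

(* An element of R^E is a function on unordered pairs of vertices; only its
   values c [set i; j] at the edges ij of G are ever used. *)
Implicit Types (c : {set 'I_n} -> R) (X : 'M[R]_n).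

Definition feasible c X : Prop :=
  [/\ psd X, forall i, X i i = 1
    & forall i j, G i j -> X i j = c [set i; j]].

Definition in_elliptope c : Prop :=
  (forall i j, G i j -> -1 <= c [set i; j] <= 1) /\ exists X, feasible c X.

Definition nondegenerate c : Prop :=
  forall i j, G i j -> -1 < c [set i; j] < 1.

Definition has_posdef_solution c : Prop := exists X, feasible c X /\ posdef X.

Definition is_max_rank c (s : nat) : Prop :=
  is_greatest (fun r => exists X, feasible c X /\ \rank X = r) s.

Record stress := Stress {
  vstress : 'I_n -> R;
  estress : {set 'I_n} -> R }.

Definition Emx (i j : 'I_n) : 'M[R]_n := 2^-1 *: (delta_mx i j + delta_mx j i).

Definition stressmx (w : stress) : 'M[R]_n :=
  \sum_(i < n) vstress w i *: Emx i i
  + \sum_(i < n) \sum_(j < n | (i < j)%N && G i j)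
      estress w [set i; j] *: Emx i j.

Definition stress_pairing (w : stress) c : R :=
  \sum_(i < n) vstress w i
  + \sum_(i < n) \sum_(j < n | (i < j)%N && G i j)
      estress w [set i; j] * c [set i; j].

(* A sequence of k stresses is indexed from 0, so that w j is the (j+1)-st
   stress; null_set w j is the common zero set of the first j quadratic forms,
   for 0 <= j <= k. *)
Definition null_set k (w : 'I_k -> stress) (j : nat) (x : 'rV[R]_n) : Prop :=
  forall i : 'I_k, (i < j)%N -> qform (stressmx (w i)) x = 0.

(* S is a linear subspace of dimension d. *)
Definition has_dim (S : 'rV[R]_n -> Prop) (d : nat) : Prop :=
  exists U : {vspace 'rV[R]_n}, (forall x, x \in U <-> S x) /\ \dim U = d.

Definition reducing_sequence c k (w : 'I_k -> stress) : Prop :=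
  [/\ forall (j : 'I_k) x,
        null_set w j x -> 0 <= qform (stressmx (w j)) x,
      forall j : 'I_k, stress_pairing (w j) c <= 0
    & exists s, is_max_rank c s /\ has_dim (null_set w k) s].

(* sd(G, c) = d; meant for c in the elliptope. *)
Definition is_sd c (d : nat) : Prop :=
  (has_posdef_solution c /\ d = 0%N) \/
  (~ has_posdef_solution c /\
   is_least (fun k => exists w : 'I_k -> stress, reducing_sequence c w) d).

End SingularityDegree.

(* sd^*(G) = d.  The maximum requires sd(G, c) to be defined for every
   nondegenerate c of the elliptope. *)
Definition is_sd_star (R : realType) n (G : sgraph n) (d : nat) : Prop :=
  (exists c : {set 'I_n} -> R,
     [/\ in_elliptope G c, nondegenerate G c & is_sd G c d]) /\
  (forall c : {set 'I_n} -> R, in_elliptope G c -> nondegenerate G c ->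
     exists k, is_sd G c k /\ (k <= d)%N).

Lemma is_sd_inj (R : realType) n (G : sgraph n) (c : {set 'I_n} -> R) d d' :
  is_sd G c d -> is_sd G c d' -> d = d'.
Proof.
case=> [[pd ->]|[npd [Pd mind]]]; case=> [[pd' ->]|[npd' [Pd' mind']]] //.
by apply/eqP; rewrite eqn_leq mind ?mind'.
Qed.

Lemma is_sd_star_inj (R : realType) n (G : sgraph n) d d' :
  is_sd_star R G d -> is_sd_star R G d' -> d = d'.
Proof.
move=> [[c [cE cN cd]] maxd] [[c' [c'E c'N c'd']] maxd'].
have [k [ck kd']] := maxd' _ cE cN; have [k' [c'k' k'd]] := maxd _ c'E c'N.
rewrite -(is_sd_inj cd ck) in kd'; rewrite -(is_sd_inj c'd' c'k') in k'd.
by apply/eqP; rewrite eqn_leq kd' k'd.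
Qed.

(* Main.v *)
Require Import Defs.
From HB Require Import structures.
From mathcomp Require Import all_boot all_order all_algebra.
From mathcomp Require Import reals.
From mathcomp Require Import ring lra.

(** For a nondegenerate c, degree 0 means that the partial matrix given by c
    has a positive definite completion (lemma sd0_posdef: with no stress at
    all, the common zero set is the whole space, so the maximum rank must be
    n, and a psd matrix of full rank is positive definite).

    If G is a forest, such a completion always exists.  The vertices are added
    in an order in which each new vertex v has at most one earlier neighbour
    u.  Viewing a completion as the Gram matrix of linearly independent unit
    vectors, the vector of v, so far orthogonal to all others, is turned
    towards that of u until the inner product is c(uv); since |c(uv)| < 1, the
    vectors stay independent (lemma forest_posdef_completion).

    If G has a cycle v_0, ..., v_{k-1}, all vertices of G are given distinct
    points on a half circle in the plane, the cycle coming first and in cyclic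
    order from (1, 0) on, and c records the inner products; these lie in
    (-1, 1), as no two points are equal or antipodal.  A feasible Y may be seen
    as a Gram matrix on a sphere.  By the spherical triangle inequality, applied
    to the triangles v_0 v_m v_{m+1}, the angle between the vectors of v_0 and
    v_m is at most the sum of the angles of the m first edges, which is the
    angle in the plane.  If Y is positive definite the inequality is strict for
    m > 1, whereas equality is prescribed at m = k - 1 by the closing edge
    (lemmas posdef_triangle_step and cycle_degenerate_point).  In terms of
    stresses, each triangle contributes a psd rank one stress, and a positive
    combination of these cancels on the chords v_0 v_m.

    Finally, a cycle of length at least 3 contracts to a triangle, and
    conversely paths inside the three branch sets of a triangle minor, joined
    by the three edges between these sets, form a cycle. *)

Set Implicit Arguments.
Unset Strict Implicit.
Unset Printing Implicit Defensive.
Import Order.TTheory GRing.Theory Num.Theory.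
Local Open Scope ring_scope.

(** * Leaves of forests *)

Section Forests.
Variables (n : nat) (G : sgraph n).

(** All neighbours of an end of a longest path lie on the path; a second
    neighbour closes a cycle with the initial segment of the path. *)
Lemma cycle_of_min_degree2 (A : {set 'I_n}) :
  A != set0 ->
  (forall v u, v \in A -> exists w, [/\ w \in A, G v w & w != u]) ->
  has_cycle G.
Proof.
case/set0Pn=> x0 x0A deg2.
pose has_path k := [exists t : k.-tuple 'I_n,
  [&& uniq t, sorted G t, all (mem A) t & (0 < k)%N]].
have path1 : exists k, has_path k.
  by exists 1%N; apply/existsP; exists [tuple x0]; rewrite /= x0A.
have path_le k : has_path k -> (k <= n)%N.
  case/existsP=> t /and4P[Ut _ _ _].
  by rewrite -(size_tuple t) -(card_uniqP Ut) -[leqRHS]card_ord max_card.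
case: (ex_maxnP path1 path_le) => k /existsP[[t /= /eqP tk] /=].
case/and4P=> Ut St /allP At k_gt0 kmax.
case: t tk Ut St At => [|x p] /= xpk; first by rewrite -xpk in k_gt0.
case/andP=> xp Up Gp At; have allA : all (mem A) (x :: p) by apply/allP.
(* By maximality of the path, it cannot be extended at x. *)
have nbr_in_p w : w \in A -> G x w -> w \in p.
  move=> wA Gxw; apply: contraT => wp.
  have wx : w != x by apply: contraTneq Gxw => ->; rewrite adj_irr.
  suff /kmax : has_path k.+1 by rewrite ltnn.
  have szt : size [:: w, x & p] == k.+1 by rewrite /= xpk.
  apply/existsP; exists (Tuple szt) => /=.
  rewrite inE negb_or wx wp xp Up adj_sym Gxw Gp wA /=.
  by rewrite andbT; exact: allA.
have xA : x \in A by apply: At; rewrite mem_head.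
have [w [wA Gxw wy]] := deg2 x (head x p) xA.
have wp := nbr_in_p w wA Gxw.
move: xp Up Gp wy; clear -wp Gxw.
case/splitPr: p / wp => p1 p2 xp Up Gp wy.
exists (x :: rcons p1 w); split.
  by case: p1 wy {xp Up Gp} => [|y p1] //=; rewrite ?eqxx ?size_rcons.
rewrite -cat_rcons in xp Up Gp.
move: xp Up Gp; rewrite mem_cat negb_or cat_uniq cat_path.
case/andP=> xp _ /andP[Up _] /andP[Gp _].
by rewrite /ucycle /= rcons_path last_rcons Gp adj_sym Gxw xp Up.
Qed.

Lemma forest_has_leaf (A : {set 'I_n}) :
  ~ has_cycle G -> A != set0 ->
  exists v u, v \in A /\ forall w, w \in A -> G v w -> w = u.
Proof.
move=> acyclic A0.
have [/existsP[v /existsP[u /andP[vA /forall_inP leaf]]]|] := boolP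
  [exists v, exists u, (v \in A) && [forall (w | w \in A), G v w ==> (w == u)]].
  exists v, u; split=> // w wA Gvw.
  by have /implyP/(_ Gvw)/eqP := leaf w wA.
move=> noleaf; case: acyclic; apply: (cycle_of_min_degree2 A0) => v u vA.
move: noleaf; rewrite negb_exists => /forallP/(_ v).
rewrite negb_exists => /forallP/(_ u); rewrite vA /=.
rewrite negb_forall_in => /exists_inP[w wA]; rewrite negb_imply.
by case/andP=> Gvw wu; exists w.
Qed.

End Forests.

(** * Cycles and triangle minors *)

Section TriangleMinor.
Variables (n : nat) (G : sgraph n).

Let within (B : {set 'I_n}) : rel 'I_n :=
  [rel u v | [&& u \in B, v \in B & G u v]].

Lemma connected_set_path x (p : seq 'I_n) :
  path G x p -> connected_set G [set y in x :: p].
Proof.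
move=> Gp; set B := [set y in _]; split.
  by apply/set0Pn; exists x; rewrite !inE eqxx.
have withinC : connect_sym (within B).
  by apply: sym_connect_sym => u v; rewrite /within /= adj_sym andbCA.
have wp : path (within B) x p.
  have BP : all (mem B) (x :: p) by apply/allP => y; rewrite [mem B y]inE.
  apply: (sub_in_path _ BP Gp) => u v uB vB Guv.
  by apply/and3P.
have xconn y : y \in B -> connect (within B) x y.
  by rewrite inE => /(path_connect wp).
by move=> y z yB zB; rewrite (connect_trans _ (xconn z zB)) // withinC xconn.
Qed.

Lemma connected_set_uniq_path (B : {set 'I_n}) x y :
  connected_set G B -> x \in B -> y \in B ->
  exists p, [/\ path G x p, last x p = y, uniq (x :: p)
              & {subset x :: p <= B}].
Proof.
case=> _ Bconn xB yB; have /connectP[p0] := Bconn x y xB yB.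
case/shortenP=> p wp Up _ ->; exists p; split=> //.
  by apply: sub_path wp => u v /and3P[].
elim: p x xB wp {Up Bconn} => [|z p IHp] x xB /=.
  by move=> _ u; rewrite inE => /eqP->.
case/andP=> /and3P[_ zB _] wp u; rewrite inE => /predU1P[-> //|].
exact: IHp.
Qed.

(** Two branch sets are the first two vertices of the cycle, the third is the
    path formed by all others. *)
Lemma cycle_triangle_minor : has_cycle G -> has_minor (complete_graph 3) G.
Proof.
case=> [[|a [|b [|d p]]] []] //= _ /andP[] /=.
rewrite rcons_path => /and4P[Gab Gbd Gp Gla].
rewrite !inE !negb_or => /andP[/and3P[ab ad ap] /and3P[/andP[bd bp] dp Up]].
pose B (i : 'I_3) : {set 'I_n} :=
  nth set0 [:: [set a]; [set b]; [set y in d :: p]] i.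
have conn1 x : connected_set G [set x].
  by have := @connected_set_path x [::] isT; congr connected_set;
     apply/setP => y; rewrite !inE.
exists B; split.
- by case=> [[|[|[|]]]] //= lti; [apply: conn1 | apply: conn1
    | apply: connected_set_path].
- have D01 : [disjoint [set a] & [set b]] by rewrite disjoints1 inE.
  have D02 : [disjoint [set a] & [set y in d :: p]].
    by rewrite disjoints1 !inE negb_or ad.
  have D12 : [disjoint [set b] & [set y in d :: p]].
    by rewrite disjoints1 !inE negb_or bd.
  by case=> [[|[|[|]]]] //= lti [[|[|[|]]]] //= ltj _;
    rewrite /B //= disjoint_sym.
- have lB : last d p \in [set y in d :: p] by rewrite inE mem_last.
  have dB : d \in [set y in d :: p] by rewrite !inE eqxx.
  have xB x : x \in [set x] by rewrite inE.
  case=> [[|[|[|]]]] //= lti [[|[|[|]]]] //= ltj _; rewrite /B /=.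
  + by exists a, b.
  + by exists a, (last d p); rewrite adj_sym.
  + by exists b, a; rewrite adj_sym.
  + by exists b, d.
  + by exists (last d p), a.
  + by exists d, b; rewrite adj_sym.
Qed.

(** Simple paths through the three branch sets are disjoint, so that their
    concatenation is a simple cycle. *)
Lemma triangle_minor_cycle : has_minor (complete_graph 3) G -> has_cycle G.
Proof.
case=> B [Bconn Bdisj Badj].
pose i0 : 'I_3 := inord 0; pose i1 : 'I_3 := inord 1; pose i2 : 'I_3 := inord 2.
have n01 : i0 != i1 by rewrite -val_eqE /= !inordK.
have n12 : i1 != i2 by rewrite -val_eqE /= !inordK.
have n20 : i2 != i0 by rewrite -val_eqE /= !inordK.
have [x0 [y1 [x0B y1B G01]]] := Badj i0 i1 n01.
have [x1 [y2 [x1B y2B G12]]] := Badj i1 i2 n12.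
have [x2 [y0 [x2B y0B G20]]] := Badj i2 i0 n20.
have [p0 [Gp0 l0 U0 S0]] := connected_set_uniq_path (Bconn i0) y0B x0B.
have [p1 [Gp1 l1 U1 S1]] := connected_set_uniq_path (Bconn i1) y1B x1B.
have [p2 [Gp2 l2 U2 S2]] := connected_set_uniq_path (Bconn i2) y2B x2B.
have disj i j (p q : seq 'I_n) : i != j -> {subset p <= B i} ->
    {subset q <= B j} -> ~~ has (mem p) q.
  move=> ij pB qB; apply/hasPn => z /qB zBj; apply/negP => /pB zBi.
  by have /pred0P/(_ z) := Bdisj i j ij; rewrite /= zBi zBj.
exists ((y0 :: p0) ++ (y1 :: p1) ++ (y2 :: p2)); split.
  by rewrite !size_cat /= !addSn !addnS.
rewrite /ucycle; apply/andP; split.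
  rewrite /= rcons_cat /= cat_path /= rcons_cat /= cat_path /= rcons_path.
  by rewrite Gp0 l0 G01 Gp1 l1 G12 Gp2 l2.
rewrite cat_uniq U0 cat_uniq U1 U2 has_cat negb_or.
by rewrite (disj i0 i1) // (disj i0 i2) 1?eq_sym // (disj i1 i2).
Qed.

End TriangleMinor.

(** * Quadratic forms *)

Section QuadraticForms.
Variables (R : realType) (n : nat).
Implicit Types (X : 'M[R]_n) (x y : 'rV[R]_n).

Definition bform X x y : R := (x *m X *m y^T) 0 0.

Lemma bformDl X x x' y : bform X (x + x') y = bform X x y + bform X x' y.
Proof. by rewrite /bform !mulmxDl mxE. Qed.

Lemma bformDr X x y y' : bform X x (y + y') = bform X x y + bform X x y'.
Proof. by rewrite /bform linearD mulmxDr mxE. Qed.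

Lemma bformZl X a x y : bform X (a *: x) y = a * bform X x y.
Proof. by rewrite /bform -!scalemxAl mxE. Qed.

Lemma bformZr X a x y : bform X x (a *: y) = a * bform X x y.
Proof. by rewrite /bform linearZ -scalemxAr mxE. Qed.

Lemma bform_delta X i j : bform X (delta_mx 0 i) (delta_mx 0 j) = X i j.
Proof. by rewrite /bform -rowE trmx_delta -colE !mxE. Qed.

Definition bformE := (bformDl, bformDr, bformZl, bformZr, bform_delta).

Lemma congruence_entry (L X : 'M[R]_n) i j :
  (L *m X *m L^T) i j = bform X (row i L) (row j L).
Proof.
rewrite /bform tr_row -row_mul -row_mul !mxE.
by apply: eq_bigr => k _; rewrite !mxE.
Qed.

Lemma qform_congruence (L X : 'M[R]_n) x :
  qform (L *m X *m L^T) x = qform X (x *m L).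
Proof. by rewrite /qform trmx_mul !mulmxA. Qed.

Lemma posdef_psd X : posdef X -> psd X.
Proof.
case=> Xsym Xpos; split=> // x; have [->|/Xpos/ltW //] := eqVneq x 0.
by rewrite /qform !mul0mx mxE.
Qed.

Lemma mulmx_tr_ge0 m (u : 'rV[R]_m) : 0 <= (u *m u^T) 0 0.
Proof. by rewrite mxE sumr_ge0 // => i _; rewrite mxE -expr2 sqr_ge0. Qed.

Lemma mulmx_tr_eq0 m (u : 'rV[R]_m) : (u *m u^T) 0 0 = 0 -> u = 0.
Proof.
rewrite mxE => u0; apply/rowP => i; rewrite mxE; apply/eqP.
have sq_ge0 j : true -> 0 <= u 0 j * u^T j 0.
  by move=> _; rewrite mxE -expr2 sqr_ge0.
by have /eqP := psumr_eq0P sq_ge0 u0 (isT : xpredT i);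
   rewrite mxE mulf_eq0 orbb.
Qed.

Lemma psd_gram m (P : 'M[R]_(n, m)) : psd (P *m P^T).
Proof.
split=> [|x]; first by rewrite trmx_mul trmxK.
by have := mulmx_tr_ge0 (x *m P); rewrite /qform trmx_mul !mulmxA.
Qed.

(** An isotropic vector x of a psd matrix lies in its kernel: otherwise the
    form would be negative at x + t (x X) for a small t < 0. *)
Lemma psd_full_rank_posdef X : psd X -> \rank X = n -> posdef X.
Proof.
case=> Xsym Xpos rkX; split=> // x x0; rewrite lt_def Xpos andbT.
apply: contra_neq x0 => qx0.
pose y := x *m X.
have xy : bform X x y = (y *m y^T) 0 0 by [].
have yx : bform X y x = (y *m y^T) 0 0.
  by rewrite /bform /y trmx_mul Xsym !mulmxA.
suff y0 : y = 0.
  have /row_freeP[Xi XXi] : row_free X by rewrite /row_free rkX.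
  by rewrite -[x]mulmx1 -XXi mulmxA -/y y0 mul0mx.
apply: mulmx_tr_eq0; apply/eqP; rewrite eq_le mulmx_tr_ge0 andbT.
set N := (y *m y^T) 0 0 in xy yx *.
have ineq t : 0 <= 2 * t * N + t ^+ 2 * qform X y.
  have := Xpos (x + t *: y).
  rewrite -[qform X _]/(bform X (x + t *: y) (x + t *: y)) !bformE xy yx.
  rewrite -[bform X x x]/(qform X x) qx0 -[bform X y y]/(qform X y).
  by move=> h; lra.
have qy := Xpos y.
have q1 : 0 < 1 + qform X y by lra.
(* Up to the 1 that avoids a division by zero, this t is the minimiser of the
   quadratic polynomial in ineq. *)
have := ineq (- N / (1 + qform X y)).
have -> : 2 * (- N / (1 + qform X y)) * N
          + (- N / (1 + qform X y)) ^+ 2 * qform X y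
   = - (N ^+ 2 * (2 + qform X y)) / (1 + qform X y) ^+ 2.
  by field; rewrite gt_eqF.
rewrite pmulr_lge0 ?invr_gt0 ?exprn_gt0 // oppr_ge0.
rewrite pmulr_lle0; last lra.
by move=> N2; rewrite leNgt; apply/negP => /(exprn_gt0 2); rewrite ltNge N2.
Qed.

End QuadraticForms.

(** * Positive definite completions for forests *)

Section ForestCompletion.
Variables (R : realType) (n : nat) (G : sgraph n) (c : {set 'I_n} -> R).

(** Induction on the set A of vertices treated so far.  The last condition
    keeps the vectors outside A orthogonal to all others, which is what leaves
    a new vertex free to turn towards its unique neighbour in A. *)
Lemma forest_posdef_completion (A : {set 'I_n}) :
  ~ has_cycle G -> Defs.nondegenerate G c ->
  exists X : 'M[R]_n,
    [/\ posdef X, forall i, X i i = 1,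
        {in A &, forall i j, G i j -> X i j = c [set i; j]}
      & forall i j, i \notin A -> i != j -> X i j = 0].
Proof.
move=> acyclic cnd; move: {2}#|A| (erefl #|A|) => m.
elim: m A => [|m IHm] A cardA.
  have A0 i : i \in A = false.
    by move/eqP: cardA; rewrite cards_eq0 => /eqP->; rewrite inE.
  exists 1%:M; split=> [|i|i j|i j _ /negPf ij]; rewrite ?mxE ?eqxx ?A0 ?ij //.
  have psd1 : psd (1%:M : 'M[R]_n).
    by rewrite -[1%:M]mulmx1 -{2}trmx1; apply: psd_gram.
  by apply: psd_full_rank_posdef; rewrite ?mxrank1.
have Ane : A != set0 by rewrite -card_gt0 cardA.
have [v [u [vA leaf]]] := forest_has_leaf acyclic Ane.
have cardAv : #|A :\ v| = m by move: cardA; rewrite (cardsD1 v) vA => -[].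
have [X [Xpd X1 Xc X0]] := IHm _ cardAv.
have vAv : v \notin A :\ v by rewrite !inE eqxx.
have Xsym i j : X i j = X j i by have [/matrixP/(_ j i)] := Xpd; rewrite mxE.
have [/andP[uA Gvu]|no_nbr] := boolP ((u \in A) && G v u); last first.
  have Gv w : w \in A -> G v w = false.
    by move=> wA; apply: contraNF no_nbr => Gvw; rewrite -(leaf w) ?wA ?Gvw.
  exists X; split=> // [i j iA jA Gij|i j iA].
    apply: Xc => //; rewrite !inE ?iA ?jA andbT.
      by apply: contraTneq Gij => ->; rewrite Gv.
    by apply: contraTneq Gij => ->; rewrite adj_sym Gv.
  by apply: X0; rewrite !inE negb_and iA orbT.
have uv : u != v by apply: contraTneq Gvu => ->; rewrite adj_irr.
set a := c [set v; u]; pose s := Num.sqrt (1 - a ^+ 2).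
have a2 : 0 < 1 - a ^+ 2.
  by have /andP[] := cnd v u Gvu; rewrite -/a => ? ?; nra.
have s2 : s ^+ 2 = 1 - a ^+ 2 by rewrite sqr_sqrtr // ltW.
have s_neq0 : s != 0 by rewrite gt_eqF // sqrtr_gt0.
(* In the Gram picture, L replaces the unit vector p_v by a p_u + s p_v, where
   p_u and p_v are orthogonal and a^2 + s^2 = 1. *)
pose L : 'M[R]_n := \matrix_i
  if i == v then a *: delta_mx 0 u + s *: delta_mx 0 v else delta_mx 0 i.
have rowLv : row v L = a *: delta_mx 0 u + s *: delta_mx 0 v.
  by rewrite rowK eqxx.
have rowL i : i != v -> row i L = delta_mx 0 i by rewrite rowK => /negPf->.
pose Y := L *m X *m L^T.
have Xv0 j : j != v -> X v j = 0 by move=> jv; rewrite X0 // eq_sym.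
have Yvj j : j != v -> Y v j = a * X u j.
  move=> jv; rewrite congruence_entry rowLv rowL // !bformE Xv0 //; ring.
have Yij i j : i != v -> j != v -> Y i j = X i j.
  by move=> iv jv; rewrite congruence_entry !rowL // bformE.
have Ysym i j : Y i j = Y j i.
  have [XT _] := Xpd.
  have YT : Y^T = Y by rewrite /Y !trmx_mul trmxK XT mulmxA.
  by rewrite -{1}YT mxE.
exists Y; split.
- split; first by apply/matrixP => i j; rewrite mxE Ysym.
  move=> x x0; rewrite qform_congruence; apply: Xpd.2.
  apply: contra_neq x0 => xL0.
  (* L is injective, because it is triangular with diagonal entries 1 and s. *)
  have xLE : x *m L = x 0 v *: (a *: delta_mx 0 u + s *: delta_mx 0 v)
                      + (x - x 0 v *: delta_mx 0 v).
    rewrite mulmx_sum_row (bigD1 v) //= rowLv; congr (_ + _).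
    apply: (addrI (x 0 v *: delta_mx 0 v)); rewrite addrCA subrr addr0.
    have := row_sum_delta x; rewrite (bigD1 v) //= => xE; rewrite [RHS]xE.
    by congr (_ + _); apply: eq_bigr => i iv; rewrite rowL.
  have xv : x 0 v = 0.
    have := congr1 (fun y : 'rV_n => y 0 v) xLE.
    rewrite xL0 !mxE !eqxx eq_sym (negPf uv) /= => /esym xvs; apply/eqP.
    by rewrite -(mulIr_eq0 _ (mulIf s_neq0)); apply/eqP; rewrite -xvs; ring.
  by move: xLE; rewrite xL0 xv !scale0r subr0 add0r.
- move=> i; have [->|iv] := eqVneq i v; last by rewrite Yij.
  rewrite congruence_entry rowLv !bformE (Xsym u v) Xv0 // !X1.
  by rewrite !mulr0 !mulr1 addr0 add0r -!expr2 s2; ring.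
- have edge_v j : j \in A -> G v j -> Y v j = c [set v; j].
    by move=> jA Gvj; rewrite (leaf j jA Gvj) Yvj // X1 mulr1.
  move=> i j iA jA Gij.
  have [iv|iv] := eqVneq i v; first by move: Gij; rewrite iv; apply: edge_v.
  have [jv|jv] := eqVneq j v.
    by move: Gij; rewrite jv Ysym setUC adj_sym; apply: edge_v.
  by rewrite Yij // Xc // !inE ?iv ?jv.
- move=> i j iA ij.
  have iv : i != v by apply: contraNneq iA => ->.
  have iu : i != u by apply: contraNneq iA => ->.
  have iAv : i \notin A :\ v by rewrite !inE negb_and iA orbT.
  have [->|jv] := eqVneq j v; last by rewrite Yij // X0.
  by rewrite Ysym Yvj // Xsym X0 ?mulr0.
Qed.

End ForestCompletion.

(** * A degenerate point for a graph with a cycle *)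

Section CycleObstruction.
Variable R : realType.

(** A strict spherical triangle inequality.  The linear dependency between the
    plane points (1, 0), (x, y) and (x', y'), which lie in this angular order
    on a half circle, is a vector q at which the Gram matrix of these points
    vanishes; positivity of Y at q compares Y with that Gram matrix. *)
Lemma posdef_triangle_step n (Y : 'M[R]_n) (i j k : 'I_n) (x y x' y' : R) :
  posdef Y -> (forall l, Y l l = 1) -> i != j -> i != k ->
  x ^+ 2 + y ^+ 2 = 1 -> x' ^+ 2 + y' ^+ 2 = 1 ->
  0 <= y -> 0 < y' -> 0 < x * y' - y * x' ->
  Y j k = x * x' + y * y' -> x <= Y i j -> x' < Y i k.
Proof.
move=> Ypd Y1 ij ik xy1 xy1' y_ge0 y'_gt0 area_gt0 Yjk Yij.
have Ysym l m : Y l m = Y m l by have [/matrixP/(_ m l)] := Ypd; rewrite mxE.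
(* The coefficients of the linear relation between the points (1, 0), (x, y)
   and (x', y') of the plane. *)
pose q : 'rV[R]_n := (x * y' - y * x') *: delta_mx 0 i
  + (- y') *: delta_mx 0 j + y *: delta_mx 0 k.
have q0 : q != 0.
  apply/eqP => /rowP/(_ i); rewrite !mxE !eqxx (negPf ij) (negPf ik) /=.
  by rewrite !mulr0 !addr0 mulr1 => area0; rewrite area0 ltxx in area_gt0.
have := Ypd.2 q q0; rewrite -[qform Y q]/(bform Y q q) !bformE.
rewrite (Ysym j i) (Ysym k i) (Ysym k j) Yjk !Y1.
set a := x * y' - y * x' in area_gt0 *.
have relation0 : a ^+ 2 + y' ^+ 2 + y ^+ 2 - 2 * a * y' * x + 2 * a * y * x'
    - 2 * y' * y * (x * x' + y * y') = 0.
  transitivity (y' ^+ 2 * (1 - (x ^+ 2 + y ^+ 2))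
                + y ^+ 2 * (1 - (x' ^+ 2 + y' ^+ 2))); first by rewrite /a; ring.
  by rewrite xy1 xy1' subrr !mulr0 addr0.
move=> pos.
have : 0 < 2 * a * (y * (Y i k - x') - y' * (Y i j - x)).
  by clearbody a; move: pos relation0; rewrite !expr2; lra.
rewrite pmulr_rgt0 ?mulr_gt0 // => pos'.
have ygap : 0 < y * (Y i k - x').
  have : 0 <= y' * (Y i j - x) by rewrite mulr_ge0 ?subr_ge0 // ltW.
  lra.
by have := ygap; rewrite pmulr_rgt0 ?subr_gt0 // lt_def y_ge0 andbT;
   apply: contraTneq ygap => ->; rewrite mul0r ltxx.
Qed.

(** The rational parametrisation of the circle: for t = 0, 1, 2, ... the points
    run from (1, 0) towards (-1, 0) on the upper half circle, which they never
    leave. *)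
Definition arc_x (t : nat) : R := (1 - t%:R ^+ 2) / (1 + t%:R ^+ 2).
Definition arc_y (t : nat) : R := 2 * t%:R / (1 + t%:R ^+ 2).

Lemma arc_den (t : nat) : 1 + t%:R ^+ 2 != 0 :> R.
Proof. by rewrite gt_eqF // ltr_pwDl // sqr_ge0. Qed.

Lemma arc_circle t : arc_x t ^+ 2 + arc_y t ^+ 2 = 1.
Proof. by rewrite /arc_x /arc_y; field; rewrite arc_den. Qed.

Lemma arc_y_gt0 t : 0 < arc_y t.+1.
Proof. by rewrite divr_gt0 ?mulr_gt0 ?ltr0n // ltr_pwDl // sqr_ge0. Qed.

(** The angle increases, by less than a half turn, from t to t + 1. *)
Lemma arc_area_gt0 t : 0 < arc_x t * arc_y t.+1 - arc_y t * arc_x t.+1.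
Proof.
have -> : arc_x t * arc_y t.+1 - arc_y t * arc_x t.+1 =
    2 * (1 + t%:R * t.+1%:R) / ((1 + t%:R ^+ 2) * (1 + t.+1%:R ^+ 2)).
  have := arc_den t.+1; rewrite /arc_x /arc_y -!natr1 => den.
  by field; rewrite den arc_den.
by rewrite divr_gt0 ?mulr_gt0 // ltr_pwDl // ?sqr_ge0 ?mulr_ge0.
Qed.

(** Distinct parameters give points that are neither equal nor antipodal. *)
Lemma arc_dot_bounds s t : s != t ->
  -1 < arc_x s * arc_x t + arc_y s * arc_y t < 1.
Proof.
move=> st.
pose d : R := (1 + s%:R ^+ 2) * (1 + t%:R ^+ 2).
have d_gt0 : 0 < d by rewrite mulr_gt0 // ltr_pwDl // sqr_ge0.
have below : arc_x s * arc_x t + arc_y s * arc_y t =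
    2 * (1 + s%:R * t%:R) ^+ 2 / d - 1.
  by rewrite /arc_x /arc_y /d; field; rewrite !arc_den.
have above : arc_x s * arc_x t + arc_y s * arc_y t =
    1 - 2 * (s%:R - t%:R) ^+ 2 / d.
  by rewrite /arc_x /arc_y /d; field; rewrite !arc_den.
apply/andP; split.
  rewrite below ltrDr divr_gt0 // mulr_gt0 // exprn_gt0 //.
  by rewrite ltr_pwDl // mulr_ge0.
rewrite above gtrBl divr_gt0 // mulr_gt0 // exprn_even_gt0 //=.
by rewrite subr_eq0 eqr_nat.
Qed.

(** The inner products of points on a half circle have no positive definite
    completion: along the cycle, a positive definite completion would exceed
    the plane inner products with the first point, yet they agree at the last
    vertex, which is adjacent to the first. *)
Lemma cycle_degenerate_point n (G : sgraph n) : has_cycle G ->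
  exists c : {set 'I_n} -> R,
    [/\ in_elliptope G c, Defs.nondegenerate G c & ~ has_posdef_solution G c].
Proof.
case=> [[|v0 p] []] //= p_gt1 /andP[Gp Us].
(* The vertices of the cycle get the parameters 0, 1, ..., size p in cyclic
   order; appending the enumeration gives all others a parameter as well. *)
pose t (i : 'I_n) := index i ((v0 :: p) ++ enum 'I_n).
have t_inj : injective t.
  move=> i j tij; rewrite -(nth_index i (s := (v0 :: p) ++ enum 'I_n) (x := i)).
    rewrite -/(t i) tij nth_index // mem_cat mem_enum orbT //.
  by rewrite mem_cat mem_enum orbT.
pose px i := arc_x (t i); pose py i := arc_y (t i).
(* By polarisation this is the inner product of the points of i and j when
   A = [set i; j], which makes c a function of the unordered pair. *)
pose c (A : {set 'I_n}) : R :=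
  ((\sum_(i in A) px i) ^+ 2 + (\sum_(i in A) py i) ^+ 2) / 2 - 1.
have cE i j : i != j -> c [set i; j] = px i * px j + py i * py j.
  move=> ij; rewrite /c !big_setU1 ?inE //= !big_set1.
  have := arc_circle (t i); have := arc_circle (t j).
  rewrite -/(px i) -/(px j) -/(py i) -/(py j) => j1 i1; lra.
have neqG i j : G i j -> i != j by apply: contraTneq => ->; rewrite adj_irr.
have cnd : Defs.nondegenerate G c.
  move=> i j /neqG ij; rewrite cE //; apply: arc_dot_bounds.
  by rewrite (inj_eq t_inj).
exists c; split=> //.
- split=> [i j Gij|]; first by have /andP[? ?] := cnd i j Gij; rewrite !ltW.
  pose P : 'M[R]_(n, 2) := \matrix_(i, k) if k == 0 then px i else py i.
  have PE i j : (P *m P^T) i j = px i * px j + py i * py j.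
    by rewrite mxE !big_ord_recl big_ord0 !mxE /= addr0.
  exists (P *m P^T); split=> [|i|i j /neqG ij]; first exact: psd_gram.
    by rewrite PE -!expr2 arc_circle.
  by rewrite PE cE.
- case=> Y [[_ Y1 Yc] Ypd].
  pose v m := nth v0 (v0 :: p) m.
  have tv m : (m <= size p)%N -> t (v m) = m.
    by move=> mp; rewrite /t index_cat mem_nth // index_uniq.
  have Gv m : (m < size p)%N -> G (v m) (v m.+1).
    by move: Gp; rewrite /= rcons_path => /andP[/(pathP v0) Gp _]; apply: Gp.
  have Glast : G (v (size p)) v0.
    by move: Gp; rewrite /= rcons_path (last_nth v0) => /andP[].
  have v0v m : (m < size p)%N -> v0 != v m.+1.
    by move=> mp; rewrite -(inj_eq t_inj) -[v0]/(v 0) !tv.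
  have c0 : arc_x 0 = 1 by rewrite /arc_x expr0n /= subr0 addr0 divr1.
  have s0 : arc_y 0 = 0 by rewrite /arc_y mulr0 mul0r.
  have Yv m : (m < size p)%N -> Y (v m) (v m.+1) =
      arc_x m * arc_x m.+1 + arc_y m * arc_y m.+1.
    by move=> mp; rewrite Yc ?Gv // cE ?neqG ?Gv // /px /py !tv // ltnW.
  have step m : (m.+1 < size p)%N -> arc_x m.+1 <= Y v0 (v m.+1) ->
      arc_x m.+2 < Y v0 (v m.+2).
    move=> mp; apply: (posdef_triangle_step Ypd Y1 _ _ (arc_circle _)
      (arc_circle _) _ _ (arc_area_gt0 _) (Yv _ mp)); rewrite ?v0v //.
    - exact: ltnW.
    - exact/ltW/arc_y_gt0.
    - exact: arc_y_gt0.
  have above m : (m < size p)%N -> arc_x m.+1 <= Y v0 (v m.+1).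
    elim: m => [|m IHm] mp; last by apply/ltW/step => //; apply/IHm/ltnW.
    by have := Yv 0 mp; rewrite -[v 0]/v0 c0 s0 mul1r mul0r addr0 => ->.
  have Ysym : Y v0 (v (size p)) = Y (v (size p)) v0.
    by have [/matrixP/(_ v0 (v (size p)))] := Ypd; rewrite mxE.
  have := Yc _ _ Glast; rewrite cE ?neqG // /px /py -[v0]/(v 0) !tv // c0 s0.
  rewrite mulr1 mulr0 addr0 -[v 0]/v0 -Ysym.
  have -> : size p = (size p).-2.+2 by case: (size p) p_gt1 => [|[|]].
  have lt2 : ((size p).-2.+1 < size p)%N by case: (size p) p_gt1 => [|[|]].
  by move=> eqY; have := step _ lt2 (above _ (ltnW lt2)); rewrite eqY ltxx.
Qed.

End CycleObstruction.

(** * Singularity degree zero *)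

(** Both cases of the definition of degree 0 amount to a positive definite
    solution: an empty sequence of stresses imposes no equation, so it is
    reducing only if some feasible matrix has full rank. *)
Lemma sd0_posdef (R : realType) n (G : sgraph n) (c : {set 'I_n} -> R) :
  is_sd G c 0 -> has_posdef_solution G c.
Proof.
case=> [[]//|[_ [[w [_ _ [s [[[X [Xfeas rkX]] _] [U [UE dimU]]]]]] _]]].
exists X; split=> //; have [Xpsd _ _] := Xfeas.
apply: psd_full_rank_posdef => //; rewrite rkX -dimU.
have -> : U = fullv.
  by apply/vspaceP => x; rewrite memvf; apply/UE => -[].
by rewrite dimvf /dim /= mul1n.
Qed.

Theorem theorem5p7 (R : realType) (n : nat) (n_gt0 : (0 < n)%N) (G : sgraph n) :
  (is_sd_star R G 0 <-> ~ has_cycle G) /\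
  (~ has_cycle G <-> ~ has_minor (complete_graph 3) G).
Proof.
split; last first.
  by split=> no; [move/triangle_minor_cycle|move/cycle_triangle_minor].
split=> [[_ sd_le0] /(cycle_degenerate_point R)[c [cE cnd]] | acyclic].
  have [k [ck k0]] := sd_le0 c cE cnd; apply; apply: sd0_posdef.
  by move: k0 ck; rewrite leqn0 => /eqP->.
have sd0 (c : {set 'I_n} -> R) :
    Defs.nondegenerate G c -> has_posdef_solution G c.
  move=> cnd.
  have [X [Xpd X1 Xc _]] := forest_posdef_completion [set: 'I_n] acyclic cnd.
  exists X; split=> //; split=> //; first exact: posdef_psd.
  by move=> i j Gij; apply: Xc; rewrite ?inE.
have nd0 : Defs.nondegenerate G (fun=> 0 : R).
  by move=> i j _; rewrite ltrN10 ltr01.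
have [X [Xfeas Xpd]] := sd0 _ nd0.
split.
  exists (fun=> 0); split=> //; last by left; split=> //; exists X.
  by split=> [i j Gij|]; [have /andP[? ?] := nd0 i j Gij; rewrite !ltW|exists X].
by move=> c _ cnd; exists 0%N; split=> //; left; split=> //; apply: sd0.
Qed.
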